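(* Let $p$ be a prime, $d$ and $\ell$ positive integers, and $0<u<p$. Let $H$ be a random finite abelian $p$-group whose type is drawn from $P_{d,u}$, and let $T_\ell(H)=|\{x\in H: p^\ell x=0\}|$. Then the expected value of $T_\ell(H)$ is \[ (u^\ell+u^{\ell-1}+\cdots+u)(1-p^{-d})+1, \] and the expected value of $T_\ell(H)-T_{\ell-1}(H)$ is $u^\ell(1-p^{-d})$.
   Context: A finite abelian $p$-group has type $\lambda=(\lambda_1\ge\cdots\ge\lambda_r\ge1)$ if it is isomorphic to $\prod_{i=1}^r\mathbb{Z}/p^{\lambda_i}\mathbb{Z}$. Write $(x)_i=(1-x)(1-x/p)\cdots(1-x/p^{i-1})$. For a partition $\lambda$: $|\lambda|=\sum\lambda_i$, $m_i(\lambda)$ is the number of parts equal to $i$, $\lambda_i'$ the $i$-th column length of its diagram, $r=\lambda_1'$ its number of parts. $P_{d,u}(\lambda)=\frac{u^{|\lambda|}}{p^{\sum_i(\lambda_i')^2}\prod_i (1/p)_{m_i(\lambda)}}\prod_{i=1}^d(1-u/p^i)\prod_{i=d-r+1}^d(1-1/p^i)$ if $r\le d$, and $0$ otherwise; this is a probability distribution on partitions. Note $T_0(H)=1$. *)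

(* Defs.v *)
From HB Require Import structures.
From mathcomp Require Import all_boot all_order all_algebra.
From mathcomp Require Import all_fingroup all_solvable.
From mathcomp Require Import all_classical all_reals all_analysis.

Set Implicit Arguments.
Unset Strict Implicit.
Unset Printing Implicit Defensive.

Import Order.TTheory GRing.Theory Num.Theory.

Local Open Scope ring_scope.

Definition is_partition (lam : seq nat) : bool :=
  sorted geq lam && all (leq 1) lam.

Definition num_parts (lam : seq nat) : nat := size lam.

Definition largest_part (lam : seq nat) : nat := head 0%N lam.

Definition column (lam : seq nat) (i : nat) : nat := count (leq i) lam.

Definition mult (lam : seq nat) (i : nat) : nat := count_mem i lam.

(* 'Z_n is the integers mod n only for n > 1; this holds for every factor here
   when p is prime and all parts of lam are positive. The group law of 'Z_n is
   addition, and the one of the dffun type is componentwise. *)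
Definition has_type (p : nat) (lam : seq nat) (gT : finGroupType)
    (G : {group gT}) : bool :=
  (G \isog [set: {dffun forall i : 'I_(size lam), 'Z_(p ^ nth 0%N lam i)}])%g.

Definition torsion_count (p l : nat) (gT : finGroupType) (G : {group gT}) : nat :=
  #|('Ldiv_(p ^ l)(G))%g|.

(* (x)_n = (1 - x)(1 - x/p)...(1 - x/p^(n-1)) *)
Definition poch (R : realType) (p : nat) (x : R) (n : nat) : R :=
  \prod_(0 <= j < n) (1 - x / p%:R ^+ j).

(* The sum over column lengths and the product over multiplicities run over
   1 <= i <= lam_1, all other terms being 0, resp. 1. *)
Definition Pdu (R : realType) (p d : nat) (u : R) (lam : seq nat) : R :=
  let r := num_parts lam in
  if (r <= d)%N then
    u ^+ sumn lam
    / (p%:R ^+ (\sum_(1 <= i < (largest_part lam).+1) column lam i ^ 2)%N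
       * \prod_(1 <= i < (largest_part lam).+1) poch p (p%:R^-1 : R) (mult lam i))
    * \prod_(1 <= i < d.+1) (1 - u / p%:R ^+ i)
    * \prod_(d - r + 1 <= i < d.+1) (1 - 1 / p%:R ^+ i)
  else 0.

(* Main.v *)
Require Import Defs.
From HB Require Import structures.
From mathcomp Require Import all_boot all_order all_algebra.
From mathcomp Require Import all_fingroup all_solvable.
From mathcomp Require Import all_classical all_reals all_analysis.
From mathcomp Require Import measurable_realfun.
From mathcomp Require Import zify ring lra.
Import Order.TTheory GRing.Theory Num.Theory.
Import numFieldNormedType.Exports.
Local Open Scope ring_scope.

Set Implicit Arguments.
Unset Strict Implicit.
Unset Printing Implicit Defensive.

(** Put q = 1/p. Under P_{d,u} the column lengths c_1 >= c_2 >= ... of the type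
    form a Markov chain started at d, absorbed at 0, with transition
    probabilities
      K_u(d,c) = u^c q^(c^2) (uq)_d (q)_d / ((q)_{d-c} (uq)_c (q)_c).
    A q-Pascal recursion gives sum_c K_u(d,c) = 1 for every u. Cancelling the
    factor 1 - q^c turns K_u(d,c) (p^c - 1) into u (1 - q^d) K_{uq}(d-1,c-1),
    so sum_c K_u(d,c) p^c = 1 + u (1 - q^d). Since T_l(H) = p^(c_1 + ... + c_l),
    conditioning on c_1 gives E_d(T_l) = sum_c K_u(d,c) p^c E_c(T_{l-1}), and the
    formula follows by induction on l. The sums over partitions are infinite;
    they are approximated by those over partitions with parts at most n, whose
    normalization tends to 1 because absorption is geometrically fast, and
    monotone convergence gives the expectation itself. *)

(** * Finite abelian p-groups of a given type *)

Lemma dffunX (I : finType) (gT : I -> finGroupType)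
    (x : {dffun forall i, gT i}) (n : nat) (i : I) :
  ((x ^+ n) i = x i ^+ n)%g.
Proof. by elim: n => [|n IHn]; rewrite ?expg0 ?expgS ffunE ?IHn. Qed.

Section GroupOfType.
Local Open Scope group_scope.
Local Open Scope nat_scope.
Variable p : nat.
Hypothesis p_prime : prime p.

Notation group_of lam := {dffun forall i : 'I_(size lam), 'Z_(p ^ nth 0 lam i)}.

Lemma part_gt0 (lam : seq nat) (i : 'I_(size lam)) :
  is_partition lam -> 0 < nth 0 lam i.
Proof. by case/andP=> _ /allP; apply; rewrite mem_nth. Qed.

Lemma expn_part_gt1 (lam : seq nat) (i : 'I_(size lam)) :
  is_partition lam -> 1 < p ^ nth 0 lam i.
Proof. by move/(part_gt0 i) => lam_gt0; rewrite -(expn0 p) ltn_exp2l ?prime_gt1. Qed.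

Lemma card_group_of (lam : seq nat) :
  is_partition lam -> #|[set: group_of lam]| = p ^ sumn lam.
Proof.
move=> part_lam.
have -> : [set: group_of lam] =
    setXn (fun i : 'I_(size lam) => [set: 'Z_(p ^ nth 0 lam i)]).
  by apply/setP=> x; rewrite inE; apply/esym/setXnP => i; rewrite inE.
rewrite cardsXn sumnE (big_nth 0) big_mkord expn_sum; apply: eq_bigr => i _.
by rewrite cardsT card_ord Zp_cast // expn_part_gt1.
Qed.

Lemma abelian_group_of (lam : seq nat) : abelian [set: group_of lam].
Proof.
apply/centsP => x _ y _; apply/ffunP => i; rewrite !ffunE.
by rewrite !FinRing.zmodMgE addrC.
Qed.

(** The unit vectors [e i] generate cyclic groups of orders p^(lam_i) whose direct product is the
    whole group, so these orders agree with the abelian type up to permutation. Both lists are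
    nonincreasing, hence equal. *)
Lemma abelian_type_group_of (lam : seq nat) :
  is_partition lam -> abelian_type [set: group_of lam] = map (expn p) lam.
Proof.
move=> part_lam; pose D := [set: group_of lam].
pose e (i : 'I_(size lam)) : group_of lam :=
  dfung1 (Zp1 : 'Z_(p ^ nth 0 lam i)).
pose b := [seq e i | i <- enum 'I_(size lam)].
have pD : p.-group D by rewrite /pgroup card_group_of // pnatX pnat_id.
have defD : \big[dprod/1%g]_(x <- b) <[x]> = D.
  rewrite big_map big_enum /=.
  transitivity (setXn (fun i : 'I_(size lam) => [set: 'Z_(p ^ nth 0 lam i)])).
    rewrite -[RHS](setXn_dprod
      (fun i : 'I_(size lam) => [set: 'Z_(p ^ nth 0 lam i)]%G)).
    apply: eq_bigr => i _ /=.
    by rewrite -morphim_dfung1 {2}Zp_cycle morphim_cycle ?inE.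
  by apply/setP=> x; rewrite [RHS]inE; apply/setXnP => i; rewrite inE.
have order_e i : #[e i] = p ^ nth 0 lam i.
  rewrite /e order_injm ?injm_dfung1 ?inE // order_Zp1 Zp_cast //.
  exact: expn_part_gt1.
have map_b : map order b = map (expn p) lam.
  rewrite -map_comp (eq_map order_e).
  rewrite -[in RHS](mkseq_nth 0 lam) /mkseq -val_enum_ord -!map_comp.
  exact: eq_map.
have nt_b : 1%g \notin b.
  apply/mapP => -[i _ /(congr1 order)]; rewrite order1 order_e => e1.
  by have := expn_part_gt1 i part_lam; rewrite -e1.
have := abelian_type_pgroup pD defD nt_b; rewrite map_b => perm_ab.
apply: (sorted_eq (leT := geq)) perm_ab.
- by move=> x y z xy /leq_trans; apply.
- by move=> x y; rewrite /geq /= -eqn_leq eq_sym => /eqP.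
- exact: abelian_type_sorted.
- case/andP: part_lam => sorted_lam _.
  apply: homo_sorted sorted_lam => x y /=; rewrite /geq /= => xy.
  by rewrite leq_exp2l ?prime_gt1.
Qed.

Lemma has_type_abelian_type (lam : seq nat) (gT : finGroupType) (G : {group gT}) :
  is_partition lam -> abelian G ->
  has_type p lam G = (abelian_type G == map (expn p) lam).
Proof.
move=> part_lam abG; rewrite /has_type.
by rewrite (@eq_abelian_type_isog _ _ G [set: group_of lam]%G) ?abelian_group_of //
  abelian_type_group_of.
Qed.

(** This makes the events attached to distinct types disjoint. *)
Lemma has_type_inj (lam mu : seq nat) (gT : finGroupType) (G : {group gT}) :
  is_partition lam -> is_partition mu -> abelian G ->
  has_type p lam G -> has_type p mu G -> lam = mu.
Proof.
move=> part_lam part_mu abG; rewrite !has_type_abelian_type // => /eqP-> /eqP.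
by apply: inj_map => x y; apply: expnI; rewrite prime_gt1.
Qed.

Lemma has_type_exists (gT : finGroupType) (G : {group gT}) :
  abelian G -> p.-group G -> exists2 lam, is_partition lam & has_type p lam G.
Proof.
move=> abG pG; pose t := abelian_type G.
have ppow m : m \in t -> exists2 k, 0 < k & m = p ^ k.
  move=> mt; have m_gt1 : 1 < m by apply: (allP (abelian_type_gt1 G)).
  have [b defG bt] := abelian_structure abG.
  have /mapP[x xb mE] : m \in map order b by rewrite bt.
  have /p_natP[k mk] : p.-nat m.
    apply: pnat_dvd pG; rewrite -(bigdprod_card defG) mE.
    by rewrite (big_rem x) //= dvdn_mulr.
  by exists k => //; case: k mk m_gt1 => [->|//]; rewrite expn0.
pose lam := map (logn p) t.
have lamt : map (expn p) lam = t.
  rewrite -map_comp -[RHS]map_id; apply/eq_in_map => m /ppow[k _ ->] /=.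
  by rewrite pfactorK.
have part_lam : is_partition lam.
  apply/andP; split; last first.
    by apply/allP => _ /mapP[m /ppow[k k_gt0 ->] ->]; rewrite pfactorK.
  have := abelian_type_sorted G; rewrite -/t -lamt sorted_map.
  apply: sub_sorted => x y /=; rewrite /geq /=.
  by rewrite leq_exp2l ?prime_gt1.
by exists lam; rewrite // has_type_abelian_type // lamt.
Qed.

(** * Counting torsion elements in cyclic groups and their products *)

Lemma card_multiples (d k : nat) : 0 < d ->
  #|[set x : 'I_(d * k) | d %| x]| = k.
Proof.
move=> d_gt0; rewrite -sum1dep_card big_mkcond /=.
rewrite (eq_bigr (fun x : 'I_(d * k) => nat_of_bool (d %| x))) => [|x _]; last first.
  by case: (d %| x).
rewrite -(big_mkord xpredT (fun x => nat_of_bool (d %| x))).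
have := divn_count_dvd d (d * k); rewrite mulKn // => {2}->.
(* The ordinals run from 0 to d k - 1, whereas [divn_count_dvd] counts from 1 to d k. Adding the
   term at d k to both sides leaves only the two endpoints to compare, and both are multiples of
   d. *)
apply: (@addIn (d %| d * k)); rewrite -big_nat_recr //=.
by rewrite big_ltn // dvdn0 dvdn_mulr // addnC.
Qed.

(** The condition on [x] is that p^a divides x p^l. It is void if a <= l; otherwise [x] ranges over
    the multiples of p^(a-l), and there are p^l of them. *)
Lemma card_Ldiv_Zp (a l : nat) : 0 < a ->
  #|'Ldiv_(p ^ l)([set: 'Z_(p ^ a)])| = p ^ minn a l.
Proof.
move=> a_gt0; have p_gt1 := prime_gt1 p_prime.
have pa_gt1 : 1 < p ^ a by rewrite -(expn0 p) ltn_exp2l.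
have -> : 'Ldiv_(p ^ l)([set: 'Z_(p ^ a)]) =
    [set x : 'Z_(p ^ a) | p ^ a %| x * p ^ l].
  apply/setP => x; rewrite !inE /= FinRing.zmodXgE Zp_mulrn FinRing.zmod1gE -val_eqE /=.
  by move: (nat_of_ord x * p ^ l) => m; rewrite Zp_cast.
rewrite Zp_cast //; case: (leqP a l) => al.
  rewrite -[RHS]card_ord -cardsT; apply: eq_card => x; rewrite !inE.
  by rewrite dvdn_mull // dvdn_exp2l.
rewrite -[in LHS](subnK (ltnW al)) expnD.
rewrite -[RHS](card_multiples (d := p ^ (a - l))) ?expn_gt0 ?(ltnW p_gt1) //.
by apply: eq_card => x; rewrite !inE dvdn_pmul2r // expn_gt0 (ltnW p_gt1).
Qed.

(** This is the number of boxes in the first [l] columns of the diagram, that is, the exponent of p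
    in T_l. *)
Definition capped_size (l : nat) (lam : seq nat) : nat :=
  \sum_(x <- lam) minn x l.

Lemma torsion_count_type (l : nat) (lam : seq nat) (gT : finGroupType)
    (G : {group gT}) :
  is_partition lam -> has_type p lam G ->
  torsion_count p l G = p ^ capped_size l lam.
Proof.
move=> part_lam /isogP[f injf im_f]; rewrite /torsion_count.
rewrite -(card_injm injf) ?subsetIl // injm_Ldiv // im_f.
have -> : 'Ldiv_(p ^ l)([set: group_of lam]) =
    setXn (fun i : 'I_(size lam) => 'Ldiv_(p ^ l)([set: 'Z_(p ^ nth 0 lam i)])).
  apply/setP => x; apply/LdivP/setXnP => [[_ x1] i|x1].
    apply/LdivP; split; first by rewrite inE.
    by rewrite -dffunX x1 ffunE.
  split; first by rewrite inE.
  apply/ffunP => i; have /LdivP[_ xi1] := x1 i.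
  by rewrite dffunX xi1 ffunE.
rewrite cardsXn /capped_size (big_nth 0) big_mkord expn_sum.
by apply: eq_bigr => i _; rewrite card_Ldiv_Zp ?part_gt0.
Qed.

End GroupOfType.

(** * Partitions built column by column *)

Section Columns.
Local Open Scope nat_scope.

(** Puts a column of length [c] in front of the diagram of [mu]. This reading needs [size mu <= c],
    since the subtraction is truncated. *)
Definition add_column (c : nat) (mu : seq nat) : seq nat :=
  map succn mu ++ nseq (c - size mu) 1.

Definition drop_column (lam : seq nat) : seq nat :=
  [seq x.-1 | x <- lam & 1 < x].

Lemma geq_trans : transitive geq.
Proof. by move=> x y z xy /leq_trans; apply. Qed.

Lemma is_partition_add_column (c : nat) (mu : seq nat) :
  is_partition mu -> is_partition (add_column c mu).
Proof.
case/andP; rewrite !sorted_pairwise; [|exact: geq_trans..] => srt pos.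
apply/andP; split; last by rewrite all_cat all_map all_predT all_nseq orbT.
rewrite sorted_pairwise; last exact: geq_trans.
rewrite pairwise_cat pairwise_map; apply/and3P; split=> //.
  by apply/allrelP => _ y /mapP[x _ ->] /nseqP[-> _].
by elim: (c - size mu) => //= k ->; rewrite all_nseq /geq /= leqnn orbT.
Qed.

Lemma size_add_column (c : nat) (mu : seq nat) :
  size mu <= c -> size (add_column c mu) = c.
Proof. by move=> mu_c; rewrite size_cat size_map size_nseq subnKC. Qed.

Lemma sumn_add_column (c : nat) (mu : seq nat) :
  size mu <= c -> sumn (add_column c mu) = c + sumn mu.
Proof.
move=> mu_c; rewrite sumn_cat sumn_nseq mul1n.
suff -> : sumn (map succn mu) = size mu + sumn mu by lia.
by elim: mu {mu_c} => //= x mu ->; lia.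
Qed.

Lemma capped_size_add_column (l c : nat) (mu : seq nat) :
  size mu <= c -> capped_size l.+1 (add_column c mu) = c + capped_size l mu.
Proof.
move=> mu_c; rewrite /capped_size big_cat big_map /=.
under eq_bigr do rewrite minnSS -addn1.
rewrite big_split /= sum1_size big_nseq minnSS min0n.
by rewrite iter_addn; lia.
Qed.

Lemma capped_size0 (lam : seq nat) : capped_size 0 lam = 0.
Proof. by rewrite /capped_size big1 // => x _; rewrite minn0. Qed.

Lemma column_add_column1 (c : nat) (mu : seq nat) :
  size mu <= c -> column (add_column c mu) 1 = c.
Proof.
move=> mu_c; rewrite -[RHS](size_add_column mu_c); apply/eqP; rewrite -all_count.
by rewrite all_cat all_map all_predT all_nseq orbT.
Qed.

Lemma column_add_columnS (c i : nat) (mu : seq nat) :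
  column (add_column c mu) i.+2 = column mu i.+1.
Proof. by rewrite /column count_cat count_map count_nseq /= mul0n addn0. Qed.

Lemma mult_add_column1 (c : nat) (mu : seq nat) :
  is_partition mu -> mult (add_column c mu) 1 = c - size mu.
Proof.
case/andP=> _ pos; rewrite /mult count_cat count_nseq /= mul1n count_map.
rewrite (_ : count _ mu = 0) //; apply/eqP; rewrite -leqn0 leqNgt -has_count.
by apply/hasPn => x /(allP pos); case: x.
Qed.

Lemma mult_add_columnS (c i : nat) (mu : seq nat) :
  mult (add_column c mu) i.+2 = mult mu i.+1.
Proof.
rewrite /mult count_cat count_nseq /= mul0n addn0 count_map.
by apply: eq_count => x /=; rewrite eqSS.
Qed.

Lemma largest_part_add_column (c : nat) (mu : seq nat) :
  size mu <= c -> 0 < c -> largest_part (add_column c mu) = (largest_part mu).+1.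
Proof. by case: mu => [|x mu] //=; case: c. Qed.

Lemma drop_columnK (lam : seq nat) :
  is_partition lam -> add_column (size lam) (drop_column lam) = lam.
Proof.
rewrite /is_partition sorted_pairwise; last exact: geq_trans.
elim: lam => [|x lam IH] //= /andP[/andP[lex srt] /andP[x_gt0 pos]].
have {}IH := IH _; rewrite srt pos in IH; have {}IH := IH isT.
rewrite /drop_column /=; case: ltnP => x1 /=.
  by rewrite /add_column /= subSS prednK // -[in RHS]IH.
have {x1 x_gt0} x1 : x = 1 by apply/eqP; rewrite eqn_leq x1 x_gt0.
have -> : [seq y <- lam | 1 < y] = [::].
  apply/eqP; rewrite -[_ == _]negbK -has_filter; apply/hasPn => y /(allP lex).
  by rewrite /geq /= x1 -leqNgt.
rewrite /add_column /= x1; congr (_ :: _); apply/esym/all_pred1P/allP => y ylam.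
have := allP lex y ylam; have := allP pos y ylam; rewrite /geq /= x1 => y0 y1.
by rewrite eqn_leq y0 y1.
Qed.

Lemma add_columnK (c : nat) (mu : seq nat) :
  is_partition mu -> drop_column (add_column c mu) = mu.
Proof.
case/andP=> _ pos; rewrite /drop_column filter_cat
  (_ : [seq x <- nseq _ _ | 1 < x] = [::]).
  rewrite cats0 filter_map (eq_in_filter (a2 := predT)) ?filter_predT.
    by rewrite -map_comp map_id.
  by move=> x /(allP pos).
by elim: (c - size mu).
Qed.

Lemma is_partition_drop_column (lam : seq nat) :
  is_partition lam -> is_partition (drop_column lam).
Proof.
case/andP=> srt pos; apply/andP; split; last first.
  by apply/allP => y /mapP[x]; rewrite mem_filter => /andP[x2 _] ->;
    case: x x2 => [|[]].
apply: (homo_sorted (e := geq)); first by move=> x y; rewrite /geq /=; lia.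
exact: (sorted_filter geq_trans).
Qed.

Lemma size_drop_column (lam : seq nat) : size (drop_column lam) <= size lam.
Proof. by rewrite size_map size_filter count_size. Qed.

(** Enumerates the partitions whose diagram fits in a box with [m] rows and [n] columns. Recursion
    on the first column makes sums over this list follow the Markov chain of columns. *)
Fixpoint partitions_in (m n : nat) : seq (seq nat) :=
  if n is n'.+1 then
    [seq add_column c mu | c <- iota 0 m.+1, mu <- partitions_in c n']
  else [:: [::]].

Lemma partitions_inP (m n : nat) (lam : seq nat) :
  (lam \in partitions_in m n) =
  [&& is_partition lam, size lam <= m & all (geq n) lam].
Proof.
elim: n m lam => [|n IHn] m lam.
  rewrite inE; apply/eqP/and3P => [->//|[/andP[_ pos] _]].
  by case: lam pos => //= x lam /andP[x0 _] /andP[]; rewrite /geq /=; lia.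
apply/allpairsPdep/and3P => [[c [mu [cm]]]|[part_lam size_lam lam_n]].
  rewrite IHn => /and3P[part_mu size_mu mu_n] ->.
  rewrite is_partition_add_column // size_add_column //; split=> //.
    by move: cm; rewrite mem_iota; lia.
  rewrite all_cat all_map all_nseq orbT andbT.
  by apply/allP => x /(allP mu_n).
exists (size lam), (drop_column lam); split; last by rewrite drop_columnK.
  by rewrite mem_iota; lia.
rewrite IHn is_partition_drop_column // size_drop_column /=.
apply/allP => y /mapP[x]; rewrite mem_filter => /andP[_ /(allP lam_n)] + ->.
by rewrite /geq /=; lia.
Qed.

Lemma partitions_in_uniq (m n : nat) : uniq (partitions_in m n).
Proof.
elim: n m => [|n IHn] m //; apply: allpairs_uniq_dep => [||].
- exact: iota_uniq.
- by move=> c _; apply: IHn.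
move=> u v /allpairsPdep[c [mu [_ + ->]]] /allpairsPdep[c' [mu' [_ + ->]]] /=.
rewrite !partitions_inP => /and3P[pm sm _] /and3P[pm' sm' _] eq_add.
have ec : c = c' by rewrite -(size_add_column sm) eq_add size_add_column.
have em : mu = mu' by rewrite -(add_columnK c pm) eq_add add_columnK.
by rewrite ec em.
Qed.

Lemma big_partitions_inS (T : Type) (idx : T) (op : Monoid.law idx) (m n : nat)
    (f : seq nat -> T) :
  \big[op/idx]_(lam <- partitions_in m n.+1) f lam =
  \big[op/idx]_(c < m.+1) \big[op/idx]_(mu <- partitions_in c n) f (add_column c mu).
Proof.
rewrite big_allpairs_dep -[RHS](big_mkord xpredT
  (fun c => \big[op/idx]_(mu <- partitions_in c n) f (add_column c mu))).
by rewrite /index_iota subn0.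
Qed.

End Columns.

(** * Transition probabilities between consecutive columns *)

Section Transition.
Variables (F : realFieldType) (q : F).
Hypotheses (q_gt0 : 0 < q) (q_lt1 : q < 1).

(* For [q = 1/p] this is (x/p)_n in the notation of [poch]. *)
Definition qprod (x : F) (n : nat) : F :=
  \prod_(1 <= i < n.+1) (1 - x * q ^+ i).

(** This is K_x(d,c). The parameter [x] stays free because the recursions below pass from [x] to
    [x * q]. *)
Definition transition (x : F) (d c : nat) : F :=
  if (c <= d)%N then
    x ^+ c * q ^+ (c ^ 2) * qprod x d * qprod 1 d
    / (qprod 1 (d - c) * qprod x c * qprod 1 c)
  else 0.

Lemma qprod0 x : qprod x 0 = 1.
Proof. by rewrite /qprod big_geq. Qed.

Lemma qprodS x n : qprod x n.+1 = qprod x n * (1 - x * q ^+ n.+1).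
Proof. by rewrite /qprod big_nat_recr. Qed.

Lemma qprodSl x n : qprod x n.+1 = (1 - x * q) * qprod (x * q) n.
Proof.
rewrite /qprod big_nat_recl //= expr1; congr (_ * _).
by apply: eq_bigr => i _; rewrite -mulrA -exprS.
Qed.

Lemma qfactor_gt0 x n : 0 <= x -> x * q < 1 -> 0 < 1 - x * q ^+ n.+1.
Proof.
move=> x_ge0 xq_lt1; rewrite subr_gt0; apply: le_lt_trans xq_lt1.
by rewrite exprS mulrA ler_piMr ?mulr_ge0 ?exprn_ile1 // ltW.
Qed.

Lemma qprod_gt0 x n : 0 <= x -> x * q < 1 -> 0 < qprod x n.
Proof.
move=> x_ge0 xq_lt1; elim: n => [|n IHn]; first by rewrite qprod0.
by rewrite qprodS mulr_gt0 ?qfactor_gt0.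
Qed.

Lemma qprod_le1 x n : 0 <= x -> x * q < 1 -> qprod x n <= 1.
Proof.
move=> x_ge0 xq_lt1; elim: n => [|n IHn]; first by rewrite qprod0.
rewrite qprodS mulr_ile1 ?(ltW (qprod_gt0 _ _ _)) ?(ltW (qfactor_gt0 _ _ _)) //.
by rewrite gerBl mulr_ge0 ?exprn_ge0 // ltW.
Qed.

Lemma qprod_antitone x m n : 0 <= x -> x * q < 1 -> (m <= n)%N ->
  qprod x n <= qprod x m.
Proof.
move=> x_ge0 xq_lt1 /subnKC <-; elim: (n - m)%N => [|k IHk].
  by rewrite addn0.
apply: le_trans IHk; rewrite addnS qprodS ler_piMr ?(ltW (qprod_gt0 _ _ _)) //.
by rewrite gerBl mulr_ge0 ?exprn_ge0 // ltW.
Qed.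

Lemma qprod1_gt0 n : 0 < qprod 1 n.
Proof. by apply: qprod_gt0; rewrite ?mul1r. Qed.

Lemma transition_ge0 x d c : 0 <= x -> x * q < 1 -> 0 <= transition x d c.
Proof.
move=> x_ge0 xq_lt1; rewrite /transition; case: ifP => // _.
by rewrite divr_ge0 // !mulr_ge0 ?exprn_ge0 // ltW ?qprod1_gt0 ?qprod_gt0.
Qed.

Lemma transition0r x d : 0 <= x -> x * q < 1 -> transition x d 0 = qprod x d.
Proof.
move=> x_ge0 xq_lt1; rewrite /transition leq0n subn0 !qprod0 !expr0 !mul1r !mulr1.
by rewrite mulfK // gt_eqF ?qprod1_gt0.
Qed.

Lemma transition0l x : transition x 0 0 = 1.
Proof. by rewrite /transition leqnn subnn exp0n // !qprod0 !expr0 !mulr1 divr1. Qed.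

(* A form of the Pascal rule for q-binomial coefficients. *)
Lemma transition_pascal x d c : 0 <= x -> x * q < 1 ->
  transition x d.+1 c.+1 =
    (1 - x * q ^+ d.+1) * transition x d c.+1
    + x * q ^+ d.+1 * transition (x * q) d c.
Proof.
move=> x_ge0 xq_lt1; rewrite /transition ltnS.
have [dc|cd] := ltnP d c.
  by rewrite ltnNge (ltnW dc) /= !mulr0 addr0.
have xq1 : 1 - x * q != 0 by rewrite gt_eqF // -[q]expr1 qfactor_gt0 //.
have nz1 n : qprod 1 n != 0 by rewrite gt_eqF ?qprod1_gt0.
have nzx n : qprod x n != 0 by rewrite gt_eqF ?qprod_gt0.
have nzf n : 1 - q ^+ n.+1 != 0.
  by rewrite -[q ^+ _]mul1r gt_eqF ?qfactor_gt0 ?mul1r.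
have nzfx n : 1 - x * q ^+ n.+1 != 0 by rewrite gt_eqF ?qfactor_gt0.
have Eq n : qprod (x * q) n = qprod x n.+1 / (1 - x * q).
  by rewrite qprodSl mulrAC mulfV ?mul1r.
have sqE : (c.+1 ^ 2 = c ^ 2 + c + c.+1)%N by lia.
rewrite !Eq subSS sqE !exprD !exprMn.
(* For c = d the term [transition x d c.+1] is 0 by the default branch, so the closed formula cannot
   be used for it. *)
have [cd'|] := ltnP c d; last first.
  move=> dc; have -> : d = c by apply/eqP; rewrite eqn_leq dc cd.
  rewrite subnn !qprodS !qprod0 !mul1r !exprS mulr0 add0r.
  (* The nonvanishing facts enter the goal so that the rewriting of powers reaches them too and they
     match the side conditions of [field]. *)
  have := (nz1 c, nzx c, nzf c, nzfx c); rewrite !exprS.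
  by move=> [[[h1 h2] h3] h4]; field; rewrite xq1 h1 h2 h3 h4.
have [m ->] : exists m, d = (c + m.+1)%N by exists (d - c).-1; lia.
rewrite addKn (_ : (c + m.+1 - c.+1)%N = m); last by lia.
rewrite !qprodS !mul1r.
have := (nz1 c, nzx c, nz1 m, nzf c, nzfx c, nzf m); rewrite -!addSn !exprD !exprS.
by move=> [[[[[h1 h2] h3] h4] h5] h6]; field; rewrite xq1 h1 h2 h3 h4 h5 h6.
Qed.

(** Induction on [d] for all [x] at once. The Pascal rule splits the terms with c > 0 into a sum at
    [x] and a full sum at [x * q]; the former lacks its term c = 0, which [qprod x d.+1] supplies
    with the right factor. The total is (1 - x q^(d+1)) + x q^(d+1). *)
Lemma sum_transition x d : 0 <= x -> x * q < 1 ->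
  \sum_(c < d.+1) transition x d c = 1.
Proof.
elim: d x => [|d IHd] x x_ge0 xq_lt1; first by rewrite big_ord1 transition0l.
rewrite big_ord_recl /= transition0r // qprodS.
under eq_bigr do rewrite /bump /= add1n transition_pascal //.
rewrite big_split /= -!mulr_sumr IHd ?mulr_ge0 ?(ltW q_gt0) //; last first.
  by apply: le_lt_trans xq_lt1; rewrite ler_piMr ?mulr_ge0 // ltW.
rewrite mulr1 addrA.
have := IHd x x_ge0 xq_lt1; rewrite big_ord_recl /= transition0r // => sumd.
rewrite big_ord_recr /= [transition x d d.+1]/transition ltnn addr0.
rewrite [qprod x d * _]mulrC -mulrDr.
by under eq_bigr do rewrite -[_.+1]/(bump 0 _); rewrite sumd mulr1 subrK.
Qed.

(** The factor 1 - q^(c+1) of [q ^- c.+1 - 1] cancels the last one of [qprod 1 c.+1]. Since (c+1)^2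
    = c^2 + c + (c+1), the remaining powers are x (xq)^c q^(c^2). *)
Lemma transitionS_invX x d c : 0 <= x -> x * q < 1 ->
  transition x d.+1 c.+1 * (q ^- c.+1 - 1) =
    x * (1 - q ^+ d.+1) * transition (x * q) d c.
Proof.
move=> x_ge0 xq_lt1; rewrite /transition ltnS subSS.
case: ifP => [cd|_]; last by rewrite mul0r mulr0.
have xq1 : 1 - x * q != 0 by rewrite gt_eqF // -[q]expr1 qfactor_gt0 //.
have nz1 n : qprod 1 n != 0 by rewrite gt_eqF ?qprod1_gt0.
have nzx n : qprod x n != 0 by rewrite gt_eqF ?qprod_gt0.
have nzf n : 1 - q ^+ n.+1 != 0.
  by rewrite -[q ^+ _]mul1r gt_eqF ?qfactor_gt0 ?mul1r.
have Eq n : qprod (x * q) n = qprod x n.+1 / (1 - x * q).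
  by rewrite qprodSl mulrAC mulfV ?mul1r.
have sqE : (c.+1 ^ 2 = c ^ 2 + c + c.+1)%N by lia.
rewrite !Eq sqE !exprD !exprMn [qprod 1 d.+1]qprodS [qprod 1 c.+1]qprodS !mul1r.
have qc : q ^+ c.+1 != 0 by rewrite expf_neq0 ?gt_eqF.
have := nzf c; move: qc (nz1 c) (nzx c.+1) (nz1 (d - c)%N).
rewrite [x ^+ c.+1]exprS.
move: (q ^+ c.+1) => Q h1 h2 h3 h4 h5; field.
by rewrite xq1 h1 h2 h3 h4 h5.
Qed.

(** The factor [q ^- c - 1] kills the term c = 0, so the index can be shifted and the total mass at
    [x * q] appears. *)
Lemma sum_transition_invX x d : 0 <= x -> x * q < 1 ->
  \sum_(c < d.+1) transition x d c * q ^- c = 1 + x * (1 - q ^+ d).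
Proof.
move=> x_ge0 xq_lt1.
suff E : \sum_(c < d.+1) transition x d c * (q ^- c - 1) = x * (1 - q ^+ d).
  rewrite -E -[X in X + _](sum_transition d x_ge0 xq_lt1) -big_split /=.
  by apply: eq_bigr => c _; rewrite mulrBr mulr1 addrC subrK.
rewrite big_ord_recl /= expr0 invr1 subrr mulr0 add0r.
case: d => [|d]; first by rewrite big_ord0 expr0 subrr mulr0.
under eq_bigr do rewrite /bump /= add1n transitionS_invX //.
rewrite -mulr_sumr sum_transition ?mulr1 ?mulr_ge0 ?(ltW q_gt0) //.
by apply: le_lt_trans xq_lt1; rewrite ler_piMr ?mulr_ge0 // ltW.
Qed.

End Transition.

(** * Truncated moments *)

Section Law.
Variables (R : realType) (p : nat) (u : R).
Hypotheses (p_prime : prime p) (u_gt0 : 0 < u) (u_ltp : u < p%:R).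

Let q : R := p%:R^-1.

Let p_gt0 : 0 < p%:R :> R. Proof. by rewrite ltr0n prime_gt0. Qed.
Let q_gt0 : 0 < q. Proof. by rewrite invr_gt0. Qed.
Let q_lt1 : q < 1. Proof. by rewrite invf_lt1 // ltr1n prime_gt1. Qed.
Let u_ge0 : 0 <= u. Proof. exact: ltW. Qed.
Let uq_lt1 : u * q < 1. Proof. by rewrite ltr_pdivrMr ?mul1r. Qed.

(** The factor of P_{d,u} that does not depend on d. *)
Definition weight (lam : seq nat) : R :=
  u ^+ sumn lam
  * q ^+ (\sum_(1 <= i < (largest_part lam).+1) column lam i ^ 2)%N
  / \prod_(1 <= i < (largest_part lam).+1) qprod q 1 (mult lam i).

Lemma poch_qprod n : poch p (p%:R^-1 : R) n = qprod q 1 n.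
Proof.
rewrite /poch /qprod big_add1 /=; apply: eq_bigr => i _.
by rewrite -exprVn mul1r exprS.
Qed.

Lemma Pdu_weight d lam : (size lam <= d)%N ->
  Pdu p d u lam =
    weight lam * qprod q u d * qprod q 1 d / qprod q 1 (d - size lam).
Proof.
move=> lam_d; rewrite /Pdu /num_parts lam_d.
rewrite (eq_bigr _ (fun i _ => poch_qprod (mult lam i))).
have -> : \prod_(1 <= i < d.+1) (1 - u / p%:R ^+ i) = qprod q u d.
  by apply: eq_bigr => i _; rewrite -exprVn.
have -> : \prod_(d - size lam + 1 <= i < d.+1) (1 - 1 / p%:R ^+ i) =
    qprod q 1 d / qprod q 1 (d - size lam).
  rewrite /qprod (@big_cat_nat _ _ _ (d - size lam).+1 1 d.+1) //=; last by lia.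
  rewrite mulrAC mulfV ?mul1r ?addn1; last by rewrite gt_eqF // qprod1_gt0.
  by apply: eq_bigr => i _; rewrite -exprVn.
by rewrite /weight invfM -exprVn !mulrA.
Qed.

Lemma weight_add_column c mu : is_partition mu -> (size mu <= c)%N ->
  weight (add_column c mu) =
    u ^+ c * q ^+ (c ^ 2) / qprod q 1 (c - size mu) * weight mu.
Proof.
(* For c = 0 both partitions are empty and the largest part does not grow, so this case is
   separate. *)
move=> part_mu mu_c; have [c0|c_gt0] := posnP c.
  move: mu_c; rewrite c0 leqn0 size_eq0 => /eqP->.
  by rewrite /weight /= !big_geq // !expr0 qprod0 !mulr1 divr1 mulr1.
rewrite /weight sumn_add_column // largest_part_add_column //.
rewrite ![\big[_/_]_(1 <= i < _.+2) _]big_ltn // !big_add1 /=.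
rewrite column_add_column1 // mult_add_column1 //.
under eq_bigr do rewrite column_add_columnS.
under [X in _ / (_ * X)]eq_bigr do rewrite mult_add_columnS.
rewrite !exprD invfM; ring.
Qed.

(** The Markov property: given a first column of length [c], the remaining diagram has law
    P_{c,u}. *)
Lemma Pdu_add_column d c mu : is_partition mu -> (size mu <= c)%N ->
  Pdu p d u (add_column c mu) = transition q u d c * Pdu p c u mu.
Proof.
move=> part_mu mu_c; have [cd|dc] := leqP c d; last first.
  rewrite /Pdu /num_parts size_add_column // leqNgt dc /=.
  by rewrite /transition leqNgt dc mul0r.
rewrite !Pdu_weight ?size_add_column // weight_add_column //.
rewrite /transition cd.
have nz1 n : qprod q 1 n != 0 by rewrite gt_eqF ?qprod1_gt0.
have nzu n : qprod q u n != 0 by rewrite gt_eqF ?qprod_gt0.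
by field; rewrite !nz1 !nzu.
Qed.

Lemma Pdu_nil d : Pdu p d u [::] = qprod q u d.
Proof.
rewrite Pdu_weight // /weight /= !big_geq // subn0 !expr0 invr1 !mul1r.
by rewrite mulfK // gt_eqF ?qprod1_gt0.
Qed.

(** The expectation of T_l under P_{d,u}, restricted to types with parts at most [n]. For l = 0 it
    is the mass of these types. *)
Definition truncated_moment (l n d : nat) : R :=
  \sum_(lam <- partitions_in d n) Pdu p d u lam * p%:R ^+ capped_size l lam.

(** Extra rows change nothing, as P_{d,u} vanishes on partitions with more than [d] parts. *)
Lemma sum_partitions_in (l n d m : nat) : (d <= m)%N ->
  \sum_(lam <- partitions_in m n) Pdu p d u lam * p%:R ^+ capped_size l lam
  = truncated_moment l n d.
Proof.
rewrite /truncated_moment; case: n => [//|n dm]; rewrite !big_partitions_inS.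
rewrite (@big_ord_widen _ _ _ d.+1 m.+1 (fun c => \sum_(mu <- partitions_in c n)
  Pdu p d u (add_column c mu) * p%:R ^+ capped_size l (add_column c mu))) //.
rewrite [RHS]big_mkcond; apply: eq_bigr => c _; case: ifPn => // dc.
rewrite big_seq big1 // => mu; rewrite partitions_inP => /and3P[pmu smu _].
by rewrite /Pdu /num_parts size_add_column // -ltnS (negbTE dc) mul0r.
Qed.

(** Conditioning on the first column [c], which contributes p^c = [q ^- c] to T_(l+1) and uses up
    one of the n+1 allowed columns. *)
Lemma truncated_momentS l n d :
  truncated_moment l.+1 n.+1 d =
  \sum_(c < d.+1) transition q u d c * q ^- c * truncated_moment l n c.
Proof.
rewrite /truncated_moment big_partitions_inS; apply: eq_bigr => c _.
rewrite mulr_sumr; apply: eq_big_seq => mu.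
rewrite partitions_inP => /and3P[pmu smu _].
by rewrite Pdu_add_column // capped_size_add_column // exprD /q exprVn invrK; ring.
Qed.

Lemma truncated_moment0S n d :
  truncated_moment 0 n.+1 d =
  \sum_(c < d.+1) transition q u d c * truncated_moment 0 n c.
Proof.
rewrite /truncated_moment big_partitions_inS; apply: eq_bigr => c _.
rewrite mulr_sumr; apply: eq_big_seq => mu.
rewrite partitions_inP => /and3P[pmu smu _].
by rewrite Pdu_add_column // !capped_size0 -mulrA.
Qed.

Lemma truncated_moment00 n : truncated_moment 0 n 0 = 1.
Proof.
elim: n => [|n IHn].
  by rewrite /truncated_moment big_seq1 Pdu_nil capped_size0 qprod0 mulr1.
by rewrite truncated_moment0S big_ord1 transition0l IHn mulr1.
Qed.

(* From any state [c <= d] the chain of columns jumps to [0] with probability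
   at least [qprod q u d]. *)
Lemma truncated_moment0_bound n d c : (c <= d)%N ->
  0 <= 1 - truncated_moment 0 n c <= (1 - qprod q u d) ^+ n.
Proof.
have qd_gt0 : 0 < qprod q u d by exact: qprod_gt0.
have qd_le1 : qprod q u d <= 1 by exact: qprod_le1.
elim: n c => [|n IHn] c cd.
  rewrite /truncated_moment big_seq1 Pdu_nil capped_size0 mulr1 expr0.
  by rewrite subr_ge0 qprod_le1 //= gerBl ltW // qprod_gt0.
have -> : 1 - truncated_moment 0 n.+1 c =
    \sum_(b < c.+1) transition q u c b * (1 - truncated_moment 0 n b).
  under [RHS]eq_bigr do rewrite mulrBr mulr1.
  by rewrite sumrB sum_transition // truncated_moment0S.
apply/andP; split.
  apply: sumr_ge0 => b _; rewrite mulr_ge0 ?transition_ge0 //.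
  by case/andP: (IHn b (leq_trans (ltn_ord b : (b <= c)%N) cd)).
(* The absorbed state b = 0 contributes nothing. The other states carry mass 1 - [qprod q u c],
   which is at most 1 - [qprod q u d] as c <= d. *)
rewrite big_ord_recl /= truncated_moment00 subrr mulr0 add0r exprS.
apply: (@le_trans _ _ (\sum_(b < c) transition q u c (bump 0 b) *
    (1 - qprod q u d) ^+ n)).
  apply: ler_sum => b _; rewrite ler_wpM2l ?transition_ge0 //.
  have bd : (bump 0 b <= d)%N by rewrite /bump /= add1n (leq_trans (ltn_ord b)).
  by case/andP: (IHn _ bd).
rewrite -mulr_suml ler_wpM2r ?exprn_ge0 ?subr_ge0 //.
have := sum_transition q_gt0 q_lt1 c u_ge0 uq_lt1.
rewrite big_ord_recl /= transition0r // => <-.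
rewrite lerBrDl lerD2r; exact: qprod_antitone.
Qed.

End Law.

(** * Expectations *)

Local Open Scope classical_set_scope.

Lemma truncated_moment_cvg (R : realType) (p : nat) (u : R) (l d : nat) :
  prime p -> 0 < u -> u < p%:R ->
  truncated_moment p u l n d @[n --> \oo] -->
    (\sum_(1 <= i < l.+1) u ^+ i) * (1 - p%:R ^- d) + 1.
Proof.
move=> p_prime u_gt0 u_ltp.
have p_gt0 : 0 < p%:R :> R by rewrite ltr0n prime_gt0.
have q_gt0 : 0 < p%:R^-1 :> R by rewrite invr_gt0.
have q_lt1 : p%:R^-1 < 1 :> R by rewrite invf_lt1 // ltr1n prime_gt1.
have uq_lt1 : u / p%:R < 1 by rewrite ltr_pdivrMr ?mul1r.
elim: l d => [|l IHl] d.
  rewrite big_geq // mul0r add0r.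
  pose k : R := 1 - qprod p%:R^-1 u d.
  apply: (@squeeze_cvgr _ _ _ _ (fun n => 1 - k ^+ n) (fun=> 1)).
  - apply: nearW => n.
    have := @truncated_moment0_bound _ _ _ p_prime u_gt0 u_ltp n d d (leqnn d).
    by rewrite subr_ge0 -/k => /andP[-> h]; rewrite andbT; lra.
  - rewrite -[X in _ --> X]subr0; apply: cvgB; first exact: cvg_cst.
    apply: cvg_expr; rewrite ger0_norm ?subr_ge0 ?qprod_le1 ?(ltW u_gt0) //.
    by rewrite ltrBlDr ltrDl qprod_gt0 // ltW.
  - exact: cvg_cst.
(* After shifting [n], the recursion writes the sequence as a finite sum over [c], whose limit is
   taken term by term with the induction hypothesis. *)
rewrite -cvg_shiftS /=.
under eq_fun do rewrite truncated_momentS //.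
set U := \sum_(1 <= i < l.+1) u ^+ i in IHl.
have -> : (\sum_(1 <= i < l.+2) u ^+ i) * (1 - p%:R ^- d) + 1 =
    \sum_(c < d.+1) transition p%:R^-1 u d c * p%:R^-1 ^- c
      * (U * (1 - p%:R ^- c) + 1).
  have -> : \sum_(1 <= i < l.+2) u ^+ i = u * (1 + U).
    rewrite big_ltn // big_add1 /= mulrDr mulr1 mulr_sumr expr1.
    by congr (_ + _); apply: eq_bigr => i _; rewrite exprS.
  (* Since p^c (U (1 - p^(-c)) + 1) = (1 + U) p^c - U, only the two known transition sums are
     needed. *)
  transitivity ((1 + U) * (\sum_(c < d.+1) transition p%:R^-1 u d c * p%:R^-1 ^- c)
      - U * \sum_(c < d.+1) transition p%:R^-1 u d c).
    rewrite sum_transition_invX // ?ltW // sum_transition // ?ltW //.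
    by rewrite exprVn; ring.
  rewrite !mulr_sumr -sumrB; apply: eq_bigr => c _.
  have pc : p%:R ^+ c != 0 :> R by rewrite expf_neq0 ?gt_eqF.
  by rewrite exprVn invrK; field.
apply: cvg_big => [|c _]; last exact: cvgMl_tmp.
exact: add_continuous.
Qed.

Section Expectation.
Variables (R : realType) (p d : nat) (u : R).
Hypotheses (p_prime : prime p) (u_gt0 : 0 < u) (u_ltp : u < p%:R).
Variables (disp : measure_display) (Omega : measurableType disp).
Variable Pr : probability Omega R.
Variables (gT : Omega -> finGroupType) (H : forall w : Omega, {group gT w}).
Hypothesis H_abelian : forall w : Omega, abelian (H w).
Hypothesis H_pgroup : forall w : Omega, pgroup p (H w).
Hypothesis H_type_measurable : forall lam : seq nat, is_partition lam ->
  measurable [set w : Omega | has_type p lam (H w)].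
Hypothesis H_type_law : forall lam : seq nat, is_partition lam ->
  Pr [set w : Omega | has_type p lam (H w)] = (Pdu p d u lam)%:E.

(** Requiring [is_partition lam] inside the event makes it empty for other sequences, hence
    measurable for every [lam], as the lemmas on sums of functions demand. *)
Let typed (lam : seq nat) : set Omega :=
  [set w | is_partition lam /\ has_type p lam (H w)].

Let measurable_typed lam : measurable (typed lam).
Proof.
have [part_lam|npart_lam] := boolP (is_partition lam).
  rewrite (_ : typed lam = [set w | has_type p lam (H w)]).
    exact: H_type_measurable.
  by apply/seteqP; split => w //= [].
rewrite (_ : typed lam = set0) //; apply/seteqP; split => w //= [].
by rewrite (negbTE npart_lam).
Qed.

Let Pr_typed lam : is_partition lam -> Pr (typed lam) = (Pdu p d u lam)%:E.
Proof.
move=> part_lam; rewrite -H_type_law //; congr (Pr _).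
by apply/seteqP; split => w //= [].
Qed.

(* Allowing [n + d] parts instead of [d] makes the convergence to the torsion
   count hold everywhere and not only almost surely. *)
Let truncated (l n : nat) (w : Omega) : \bar R :=
  (\sum_(lam <- partitions_in (n + d) n)
     (p%:R ^+ capped_size l lam)%:E * (\1_(typed lam) w)%:E)%E.

(** By uniqueness of the type, at most one indicator in the sum is nonzero at [w]. *)
Let truncatedE l n w lam : is_partition lam -> has_type p lam (H w) ->
  truncated l n w =
  if lam \in partitions_in (n + d) n then (torsion_count p l (H w))%:R%:E else 0%E.
Proof.
move=> part_lam type_lam.
have off mu : mu != lam -> (\1_(typed mu) w : R) = 0.
  move=> mu_lam; rewrite indicE memNset //= => -[part_mu type_mu].
  by move/eqP: mu_lam; apply; exact: has_type_inj type_mu type_lam.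
case: ifPn => [lam_in|lam_notin].
  rewrite /truncated (bigD1_seq lam) ?partitions_in_uniq //=.
  rewrite big1 => [|mu mu_lam]; last by rewrite off // mule0.
  rewrite adde0 indicE mem_set // mule1 (torsion_count_type p_prime _ part_lam) //.
  by rewrite natrX.
rewrite /truncated big_seq big1 // => mu mu_in; rewrite off ?mule0 //.
by apply: contraNneq lam_notin => <-.
Qed.

Let truncated_ge0 l n w : (0 <= truncated l n w)%E.
Proof. by apply: sume_ge0 => lam _; rewrite mule_ge0 // lee_fin ?exprn_ge0. Qed.

Let measurable_truncated l n : measurable_fun setT (truncated l n).
Proof.
apply: emeasurable_sum => lam; apply/measurable_EFinP.
by apply: measurable_funM; [exact: measurable_cst|exact: measurable_indic].
Qed.

Let truncated_nondecreasing l w :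
  {homo (truncated l)^~ w : m n / (m <= n)%N >-> (m <= n)%E}.
Proof.
move=> m n mn.
have [lam part_lam type_lam] := has_type_exists p_prime (H_abelian w) (H_pgroup w).
rewrite !(truncatedE _ _ part_lam type_lam).
case: ifPn => [|_]; last by case: ifP; rewrite // lee_fin.
rewrite !partitions_inP => /and3P[-> size_lam lam_m].
rewrite (leq_trans size_lam) ?leq_add2r //=.
case: ifPn => // /allPn[x /(allP lam_m) /= xm]; rewrite -ltnNge => nx.
by have := leq_ltn_trans mn nx; rewrite ltnNge xm.
Qed.

Let truncated_cvg l w :
  truncated l n w @[n --> \oo] --> (torsion_count p l (H w))%:R%:E.
Proof.
have [lam part_lam type_lam] := has_type_exists p_prime (H_abelian w) (H_pgroup w).
(* From this index on the box contains the type: [sumn lam] bounds every part. *)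
apply: cvg_near_cst; exists (maxn (size lam) (sumn lam)) => // n /=.
rewrite geq_max => /andP[size_n sum_n].
rewrite (truncatedE _ _ part_lam type_lam) partitions_inP part_lam.
rewrite (leq_trans size_n) ?leq_addr //=.
case: ifPn => // /allPn[x xlam] /=; rewrite -ltnNge => nx.
have : (x <= sumn lam)%N by rewrite sumnE (big_rem x) //= leq_addr.
by lia.
Qed.

Let integral_truncated l n :
  (\int[Pr]_w truncated l n w)%E = (truncated_moment p u l n d)%:E.
Proof.
rewrite ge0_integral_sum //; last first.
  move=> lam; apply/measurable_EFinP.
  by apply: measurable_funM; [exact: measurable_cst|exact: measurable_indic].
rewrite -(sum_partitions_in p u l n (leq_addl n d)) -sumEFin.
apply: eq_big_seq => lam; rewrite partitions_inP => /and3P[part_lam _ _].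
rewrite ge0_integralZl_EFin ?exprn_ge0 //; last first.
  by apply/measurable_EFinP; exact: measurable_indic.
rewrite integral_indic // setIT [Pdu _ _ _ _ * _]mulrC EFinM; congr (_ * _)%E.
exact: Pr_typed.
Qed.

Lemma integral_torsion_count l :
  (\int[Pr]_w (torsion_count p l (H w))%:R%:E)%E =
  ((\sum_(1 <= i < l.+1) u ^+ i) * (1 - p%:R ^- d) + 1)%:E.
Proof.
have := @cvg_monotone_convergence _ _ _ Pr setT measurableT (truncated l)
  (measurable_truncated l) (fun n w _ => truncated_ge0 l n w)
  (fun w _ => @truncated_nondecreasing l w).
under eq_integral do rewrite (cvg_lim _ (@truncated_cvg l _)) //.
under eq_fun do rewrite integral_truncated.
(* The integral from monotone convergence and the closed formula are limits of the same truncated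
   moments. *)
move=> cvg_int; apply: cvg_unique cvg_int _ => //.
apply: cvg_EFin; first by apply: nearW.
exact: truncated_moment_cvg.
Qed.

Lemma measurable_torsion_count l :
  measurable_fun setT (fun w => (torsion_count p l (H w))%:R%:E : \bar R).
Proof.
by apply: (emeasurable_fun_cvg (truncated l)) => // w _; exact: truncated_cvg.
Qed.

(** Finiteness of the integral is what permits splitting the expectation of the difference. *)
Lemma integrable_torsion_count l :
  Pr.-integrable setT (fun w => (torsion_count p l (H w))%:R%:E).
Proof.
apply/integrableP; split; first exact: measurable_torsion_count.
under eq_integral do rewrite gee0_abs ?lee_fin //.
by rewrite integral_torsion_count ltry.
Qed.

End Expectation.

Unset Implicit Arguments.

Theorem theorem5p4 (R : realType) (p d l : nat) (u : R)
    (p_prime : prime p) (d_gt0 : (0 < d)%N) (l_gt0 : (0 < l)%N)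
    (u_gt0 : 0 < u) (u_ltp : u < p%:R)
    (disp : measure_display) (Omega : measurableType disp)
    (Pr : probability Omega R)
    (gT : Omega -> finGroupType) (H : forall w : Omega, {group gT w})
    (H_abelian : forall w : Omega, abelian (H w))
    (H_pgroup : forall w : Omega, pgroup p (H w))
    (H_type_measurable : forall lam : seq nat, is_partition lam ->
       measurable [set w : Omega | has_type p lam (H w)])
    (H_type_law : forall lam : seq nat, is_partition lam ->
       Pr [set w : Omega | has_type p lam (H w)] = (Pdu p d u lam)%:E) :
  expectation Pr (fun w : Omega => (torsion_count p l (H w))%:R : R)
    = ((\sum_(1 <= i < l.+1) u ^+ i) * (1 - p%:R ^- d) + 1)%:E
  /\
  expectation Pr (fun w : Omega =>
      (torsion_count p l (H w))%:R - (torsion_count p l.-1 (H w))%:R : R)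
    = (u ^+ l * (1 - p%:R ^- d))%:E.
Proof.
have E k := integral_torsion_count p_prime u_gt0 u_ltp H_abelian H_pgroup
  H_type_measurable H_type_law k.
have I k := integrable_torsion_count p_prime u_gt0 u_ltp H_abelian H_pgroup
  H_type_measurable H_type_law k.
rewrite expectation.unlock; split; first exact: E.
under eq_integral do rewrite EFinB.
rewrite integralB_EFin //; [|exact: I..].
(* As 0 < l, [prednK] turns the upper bound [l.-1.+1] into [l], and the two sums differ only by the
   last term u^l. *)
rewrite !E -EFinB prednK //; congr (_%:E).
by rewrite big_nat_recr //=; ring.
Qed.
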